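(* Let $M_{\mathrm{obj}},B\in\mathbb{S}^{n+1}$ and $\mathcal{M}\subseteq\mathbb{S}^{n+1}$. Suppose that $\mathcal{S}(\mathcal{M})$ is rank-one generated, that there exist $M^*\in\mathrm{clcone}(\mathcal{M})$ and $\lambda\in\mathbb{R}$ such that $M_{\mathrm{obj}}+M^*+\lambda B\succeq0$, and that $$\mathrm{cl}\{z\in\mathbb{R}^{n+1}:\ zz^\top\in\mathcal{S}(\mathcal{M}),\ z_{n+1}^2>0\}=\{z\in\mathbb{R}^{n+1}:\ zz^\top\in\mathcal{S}(\mathcal{M})\}.$$ Then the following four quantities are all equal: $$\inf_{\tilde z\in\mathbb{R}^{n+1}}\left\{\frac{\tilde z^\top M_{\mathrm{obj}}\tilde z}{\tilde z^\top B\tilde z}:\ \tilde z\tilde z^\top\in\mathcal{S}(\mathcal{M}),\ \tilde z^\top B\tilde z>0,\ \tilde z_{n+1}^2=1\right\},$$ $$\inf_{z\in\mathbb{R}^{n+1}}\left\{z^\top M_{\mathrm{obj}}z:\ zz^\top\in\mathcal{S}(\mathcal{M}),\ z^\top Bz=1,\ z_{n+1}^2>0\right\},$$ $$\inf_{z\in\mathbb{R}^{n+1}}\left\{z^\top M_{\mathrm{obj}}z:\ zz^\top\in\mathcal{S}(\mathcal{M}),\ z^\top Bz=1\right\},$$ $$\inf_{Z\in\mathbb{S}^{n+1}}\left\{\langle M_{\mathrm{obj}},Z\rangle:\ Z\in\mathcal{S}(\mathcal{M}),\ \langle B,Z\rangle=1\right\}.$$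
   Context: $\mathbb{S}^{n+1}$ is the space of real symmetric $(n+1)\times(n+1)$ matrices, $\mathbb{S}^{n+1}_+$ the cone of positive semidefinite ones, $\langle\cdot,\cdot\rangle$ the trace inner product. $\mathrm{cl}$ denotes closure and $\mathrm{clcone}(\mathcal{M})$ the closure of the conic hull (all finite nonnegative combinations) of $\mathcal{M}$. An infimum over the empty set is $+\infty$. For an arbitrary (possibly infinite) $\mathcal{M}\subseteq\mathbb{S}^{n+1}$, $$\mathcal{S}(\mathcal{M})=\{Z\in\mathbb{S}^{n+1}:\ Z\succeq0,\ \langle M,Z\rangle\le0\ \ \forall M\in\mathcal{M}\}.$$ A closed convex cone $\mathcal{S}\subseteq\mathbb{S}^{n+1}_+$ is rank-one generated (ROG) if $\mathcal{S}=\mathrm{conv}(\mathcal{S}\cap\{zz^\top:z\in\mathbb{R}^{n+1}\})$. *)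

(* Defs.v *)
From HB Require Import structures.
From mathcomp Require Import all_boot all_order all_algebra.
From mathcomp Require Import all_classical all_reals all_analysis.

Set Implicit Arguments.
Unset Strict Implicit.
Unset Printing Implicit Defensive.

Import Order.TTheory GRing.Theory Num.Theory.
Import numFieldNormedType.Exports.

Local Open Scope classical_set_scope.
Local Open Scope ring_scope.

(* The quadratic form z^T A z, read off the 1 x 1 matrix product. *)
Definition qform (R : realType) (m : nat) (A : 'M[R]_m) (z : 'cV[R]_m) : R :=
  (z^T *m A *m z) ord0 ord0.

Definition outer (R : realType) (m : nat) (z : 'cV[R]_m) : 'M[R]_m := z *m z^T.

Definition mxinner (R : realType) (m : nat) (A B : 'M[R]_m) : R :=
  \tr (A^T *m B).

Definition psd (R : realType) (m : nat) (A : 'M[R]_m) : Prop :=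
  A \is symmetricmx /\ forall z : 'cV[R]_m, 0 <= qform A z.

(* The empty combination (k = 0) is allowed, so 0 always belongs to the hull. *)
Definition conic_hull (R : realType) (V : lmodType R) (X : set V) : set V :=
  [set v | exists (k : nat) (c : 'I_k -> R) (x : 'I_k -> V),
    [/\ forall i, 0 <= c i, forall i, X (x i) & v = \sum_(i < k) c i *: x i]].

Definition conv_hull (R : realType) (V : lmodType R) (X : set V) : set V :=
  [set v | exists (k : nat) (c : 'I_k -> R) (x : 'I_k -> V),
    [/\ forall i, 0 <= c i, \sum_(i < k) c i = 1, forall i, X (x i)
      & v = \sum_(i < k) c i *: x i]].

(* The symmetric matrices are closed in 'M[R]_m, so closing there is the same
   as closing in the space of symmetric matrices. *)
Definition clcone (R : realType) (m : nat) (M : set 'M[R]_m) : set 'M[R]_m :=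
  closure (conic_hull M).

Definition sdp_cone (R : realType) (m : nat) (M : set 'M[R]_m) : set 'M[R]_m :=
  [set Z | psd Z /\ forall A, M A -> mxinner A Z <= 0].

(* Meant for closed convex cones S of positive semidefinite matrices, such as
   every sdp_cone. *)
Definition rank_one_generated (R : realType) (m : nat) (S : set 'M[R]_m) : Prop :=
  S = conv_hull (S `&` range (@outer R m)).

(* Main.v *)
(* The cone S(M) is invariant under Z |-> a^2 Z, so both quotients and
   normalised problems can be compared by rescaling z; this gives v1 = v2, and
   together with the density assumption and continuity of quadratic forms it
   gives v2 = v3.  For v3 <= v4, dual feasibility yields
   z^T Mobj z + lambda z^T B z >= 0 on the rank-one elements of S(M), whence
   v3 + lambda >= 0.  Then z^T Mobj z >= v3 (z^T B z) holds for every rank-one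
   element: by rescaling if z^T B z > 0, and from
   z^T Mobj z >= - lambda (z^T B z) >= v3 (z^T B z) otherwise.  Summing over a
   rank-one decomposition of Z gives <Mobj, Z> >= v3 <B, Z>. *)
Require Import Defs.
From HB Require Import structures.
From mathcomp Require Import all_boot all_order all_algebra.
From mathcomp Require Import all_classical all_reals all_analysis.
From mathcomp Require Import lra.

Import Order.TTheory GRing.Theory Num.Theory.
Import numFieldNormedType.Exports.

Local Open Scope classical_set_scope.
Local Open Scope ring_scope.

Lemma continuous_bigsum (R : realType) (T : topologicalType) (I : Type)
    (r : seq I) (f : I -> T -> R) :
  (forall i, continuous (f i)) -> continuous (fun x => \sum_(i <- r) f i x).
Proof.
move=> cf x; elim: r => [|i r IHr].
  under eq_fun do rewrite big_nil; exact: cvg_cst.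
under eq_fun do rewrite big_cons.
by apply: cvgD => //; exact: cf.
Qed.

Section QuadraticForms.
Context {R : realType} {m : nat}.
Implicit Types (A Z : 'M[R]_m) (z : 'cV[R]_m) (a : R).

Lemma qformD A Z z : qform (A + Z) z = qform A z + qform Z z.
Proof. by rewrite /qform mulmxDr mulmxDl mxE. Qed.

Lemma qformZ a A z : qform (a *: A) z = a * qform A z.
Proof. by rewrite /qform -scalemxAr -scalemxAl mxE. Qed.

Lemma qformZv a A z : qform A (a *: z) = a ^+ 2 * qform A z.
Proof.
by rewrite /qform [(_ *: _)^T]linearZ /= -!scalemxAl -scalemxAr scalerA mxE expr2.
Qed.

Lemma outerZ a z : outer (a *: z) = a ^+ 2 *: outer z.
Proof. by rewrite /outer [(_ *: _)^T]linearZ /= -scalemxAl -scalemxAr scalerA expr2. Qed.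

Lemma qform_continuous A : continuous (qform A).
Proof.
have -> : qform A =
    fun z => \sum_i (\sum_j z j ord0 * A j i) * z i ord0.
  apply/funext => z; rewrite /qform mxE; apply: eq_bigr => i _.
  by rewrite mxE; under eq_bigr do rewrite mxE.
apply: continuous_bigsum => i z.
apply: (@continuousM R 'cV[R]_m (fun z => \sum_j z j ord0 * A j i)); last first.
  exact: coord_continuous.
apply: continuous_bigsum => j {}z.
apply: (@continuousM R 'cV[R]_m (fun z => z j ord0)); last exact: cst_continuous.
exact: coord_continuous.
Qed.

Lemma mxinnerZl a A Z : mxinner (a *: A) Z = a * mxinner A Z.
Proof. by rewrite /mxinner linearZ /= -scalemxAl linearZ. Qed.

Lemma mxinner_suml k (F : 'I_k -> 'M[R]_m) Z :
  mxinner (\sum_(i < k) F i) Z = \sum_(i < k) mxinner (F i) Z.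
Proof. by rewrite /mxinner !linear_sum mulmx_suml linear_sum. Qed.

Lemma mxinner_sumr k (F : 'I_k -> 'M[R]_m) A :
  mxinner A (\sum_(i < k) F i) = \sum_(i < k) mxinner A (F i).
Proof. by rewrite /mxinner mulmx_sumr linear_sum. Qed.

Lemma mxinnerZr a A Z : mxinner A (a *: Z) = a * mxinner A Z.
Proof. by rewrite /mxinner -scalemxAr linearZ. Qed.

Lemma mxinner_outer A z : mxinner A (outer z) = qform A z.
Proof.
rewrite /mxinner /outer /qform mulmxA mxtrace_mulC /mxtrace big_ord1.
(* Cyclicity has left the entry of the 1 x 1 matrix [z^T *m (A^T *m z)], which is the transpose of
   [z^T *m A *m z]. *)
by rewrite -[in RHS](trmxK (z^T *m A *m z)) [in RHS]mxE !trmx_mul trmxK.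
Qed.

Lemma mxinner_continuous Z : continuous (fun A => mxinner A Z).
Proof.
have -> : (fun A => mxinner A Z) = fun A => \sum_i \sum_j A j i * Z j i.
  apply/funext => A; apply: eq_bigr => i _.
  by rewrite mxE; under eq_bigr do rewrite mxE.
apply: continuous_bigsum => i; apply: continuous_bigsum => j A.
apply: (@continuousM R 'M[R]_m (fun A => A j i)); last exact: cst_continuous.
exact: coord_continuous.
Qed.

Lemma sdp_coneZ (M : set 'M[R]_m) a Z :
  0 <= a -> sdp_cone M Z -> sdp_cone M (a *: Z).
Proof.
move=> a0 [[sZ pZ] MZ]; split; first split.
(* Symmetric is encoded as hermitian with sign [(-1) ^+ 0] and the identity as conjugation; once the
   sign is removed, linearity of transposition suffices. *)
- apply/is_hermitianmxP; move/is_hermitianmxP: sZ.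
  by rewrite !expr0 !scale1r linearZ map_mxZ /= => <-.
- by move=> z; rewrite qformZ mulr_ge0.
- by move=> A MA; rewrite mxinnerZr mulr_ge0_le0 // MZ.
Qed.

(** For fixed [Z] the half-space of all [A] with [mxinner A Z <= 0] is a closed convex cone
    containing [M], hence contains [clcone M]. *)
Lemma clcone_sdp_cone_le0 (M : set 'M[R]_m) A Z :
  clcone M A -> sdp_cone M Z -> mxinner A Z <= 0.
Proof.
move=> clA [_ MZ].
have cl0 : closed [set A : 'M[R]_m | mxinner A Z <= 0].
  apply: (@preimage_closed _ _ (fun A => mxinner A Z) [set x : R | x <= 0]).
    by move=> ? _; exact: mxinner_continuous.
  exact: closed_le.
apply: cl0; apply: closureS clA => _ [k [c [x [c0 Mx ->]]]] /=.
rewrite mxinner_suml; apply: sumr_le0 => i _.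
by rewrite mxinnerZl mulr_ge0_le0 // MZ.
Qed.

Lemma sdp_cone_outer_scale (M : set 'M[R]_m) a z :
  sdp_cone M (outer z) -> sdp_cone M (outer (a *: z)).
Proof. by rewrite outerZ; apply: sdp_coneZ; exact: sqr_ge0. Qed.

Lemma qform_normalize A z :
  0 < qform A z -> qform A ((Num.sqrt (qform A z))^-1 *: z) = 1.
Proof.
by move=> A0; rewrite qformZv exprVn sqr_sqrtr ?ltW// mulVf// gt_eqF.
Qed.

Lemma qform_normalize_ratio A A' z : 0 < qform A z ->
  qform A' ((Num.sqrt (qform A z))^-1 *: z) = qform A' z / qform A z.
Proof. by move=> A0; rewrite qformZv exprVn sqr_sqrtr ?ltW// mulrC. Qed.

End QuadraticForms.

Theorem lemma14 (R : realType) (n : nat) (Mobj B : 'M[R]_n.+1)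
    (M : set 'M[R]_n.+1)
    (Mobj_sym : Mobj \is symmetricmx)
    (B_sym : B \is symmetricmx)
    (M_sym : forall A : 'M[R]_n.+1, M A -> A \is symmetricmx)
    (M_rog : rank_one_generated (sdp_cone M))
    (dual_feasible : exists (Mstar : 'M[R]_n.+1) (lambda : R),
        clcone M Mstar /\ psd (Mobj + Mstar + lambda *: B))
    (dense : closure [set z : 'cV[R]_n.+1 |
                 sdp_cone M (outer z) /\ 0 < z ord_max ord0 ^+ 2]
             = [set z : 'cV[R]_n.+1 | sdp_cone M (outer z)]) :
  let v1 : \bar R := ereal_inf
    [set (qform Mobj z / qform B z)%:E | z in
      [set z : 'cV[R]_n.+1 | [/\ sdp_cone M (outer z), 0 < qform B z
                               & z ord_max ord0 ^+ 2 = 1]]] in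
  let v2 : \bar R := ereal_inf
    [set (qform Mobj z)%:E | z in
      [set z : 'cV[R]_n.+1 | [/\ sdp_cone M (outer z), qform B z = 1
                               & 0 < z ord_max ord0 ^+ 2]]] in
  let v3 : \bar R := ereal_inf
    [set (qform Mobj z)%:E | z in
      [set z : 'cV[R]_n.+1 | sdp_cone M (outer z) /\ qform B z = 1]] in
  let v4 : \bar R := ereal_inf
    [set (mxinner Mobj Z)%:E | Z in
      [set Z : 'M[R]_n.+1 | sdp_cone M Z /\ mxinner B Z = 1]] in
  [/\ v1 = v2, v2 = v3 & v3 = v4].
Proof.
move=> v1 v2 v3 v4.
(* Dividing [z] by the square root of [qform B z] makes the constraint an equality and turns the
   objective into the ratio. *)
have v2_ratio z : sdp_cone M (outer z) -> 0 < qform B z ->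
    0 < z ord_max ord0 ^+ 2 -> (v2 <= (qform Mobj z / qform B z)%:E)%E.
  move=> Sz Bz z0; apply: ereal_inf_lbound.
  exists ((Num.sqrt (qform B z))^-1 *: z); last by rewrite qform_normalize_ratio.
  split; [exact: sdp_cone_outer_scale|exact: qform_normalize|].
  by rewrite mxE exprMn mulr_gt0// exprn_gt0// invr_gt0 sqrtr_gt0.
have v3_ratio z : sdp_cone M (outer z) -> 0 < qform B z ->
    (v3 <= (qform Mobj z / qform B z)%:E)%E.
  move=> Sz Bz; apply: ereal_inf_lbound.
  exists ((Num.sqrt (qform B z))^-1 *: z); last by rewrite qform_normalize_ratio.
  by split; [exact: sdp_cone_outer_scale|exact: qform_normalize].
split; apply/eqP; rewrite eq_le; apply/andP; split.
(* Dividing by the last coordinate makes it 1; the ratio is unchanged, and equals [qform Mobj z]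
   because [qform B z = 1]. *)
- apply: le_ereal_inf_tmp => _ [z [Sz Bz z0] <-]; apply: ereal_inf_lbound.
  have zn0 : z ord_max ord0 != 0 by rewrite -sqrf_eq0 gt_eqF.
  have z20 : (z ord_max ord0)^-1 ^+ 2 != 0 by rewrite expf_neq0// invr_eq0.
  exists ((z ord_max ord0)^-1 *: z); last first.
    by rewrite !qformZv Bz mulr1 [X in X / _]mulrC mulfK.
  split; first exact: sdp_cone_outer_scale.
    by rewrite qformZv Bz mulr1 exprVn invr_gt0.
  by rewrite mxE mulVf// expr1n.
- apply: le_ereal_inf_tmp => _ [z [Sz Bz z1] <-].
  by apply: v2_ratio => //; rewrite z1.
- apply: le_ereal_inf_tmp => _ [z [Sz Bz] <-].
  (* Nearby points [w] with nonzero last coordinate may violate [qform B w = 1], so the ratio at [w]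
     is used: it is continuous at [z], where it equals [qform Mobj z]. *)
  apply/lee_addgt0Pr => e e0.
  have cB : qform B w @[w --> z] --> (1 : R).
    by rewrite -Bz; exact: qform_continuous.
  have cM : qform Mobj w / qform B w @[w --> z] --> qform Mobj z.
    rewrite -[X in _ --> X]divr1.
    exact: cvgM (qform_continuous Mobj z) (cvgV (oner_neq0 R) cB).
  have nz : \forall w \near z,
      0 < qform B w /\ qform Mobj w / qform B w < qform Mobj z + e.
    apply: filterI.
      by apply: (cvgr_gt _ cB); exact: ltr01.
    by apply: (cvgr_lt _ cM); rewrite ltrDl.
  have : closure [set z : 'cV[R]_n.+1 |
      sdp_cone M (outer z) /\ 0 < z ord_max ord0 ^+ 2] z by rewrite dense.
  move=> /(_ _ nz) [w [[Sw w0] [Bw Mw]]].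
  by apply: le_trans (v2_ratio w Sw Bw w0) _; rewrite -EFinD lee_fin ltW.
- by apply: ereal_inf_le_tmp => _ [z [Sz Bz _] <-]; exists z.
- apply: le_ereal_inf_tmp => _ [Z [SZ BZ] <-].
  have [Mstar [lambda [clM [_ dual]]]] := dual_feasible.
  have dual_ge0 z : sdp_cone M (outer z) ->
      0 <= qform Mobj z + lambda * qform B z.
    move=> Sz; have := dual z; rewrite !qformD qformZ.
    have := clcone_sdp_cone_le0 M _ _ clM Sz; rewrite mxinner_outer; lra.
  move: SZ BZ; rewrite [X in X Z -> _]M_rog => -[k [c [x [c0 _ Sx ->]]]].
  have {Sx} /choice[z zP] i : exists z, sdp_cone M (outer z) /\ x i = outer z.
    by have [Sxi [z _ xE]] := Sx i; exists z; rewrite xE.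
  rewrite !mxinner_sumr.
  have innerE A : \sum_(i < k) mxinner A (c i *: x i)
                  = \sum_(i < k) c i * qform A (z i).
    by apply: eq_bigr => i _; rewrite mxinnerZr (zP i).2 mxinner_outer.
  rewrite !innerE => sB1.
  (* A nonnegative combination of nonpositive values cannot be 1. The resulting feasible point rules
     out [v3 = +oo]; the bound [- lambda] below rules out [-oo]. *)
  have [i Bi] : exists i, 0 < qform B (z i).
    apply/existsP; rewrite -[X in is_true X]negbK negb_exists.
    apply/negP => /forallP B_le0.
    suff : \sum_(i < k) c i * qform B (z i) <= 0 by rewrite sB1 ler10.
    by apply: sumr_le0 => i _; rewrite mulr_ge0_le0// leNgt.
  have v3_ge : ((- lambda)%:E <= v3)%E.
    apply: le_ereal_inf_tmp => _ [w [Sw Bw] <-].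
    by have := dual_ge0 w Sw; rewrite lee_fin Bw; lra.
  have v3_fin := v3_ratio _ (zP i).1 Bi.
  case: (v3) v3_ge v3_fin v3_ratio => // v; rewrite !lee_fin => v_ge _ v_ratio.
  (* Writing [v] as [v] times the sum of the [c i * qform B (z i)] reduces the claim to a termwise
     comparison. *)
  rewrite -[v]mulr1 -sB1 mulr_sumr; apply: ler_sum => j _.
  rewrite mulrCA ler_wpM2l//.
  have [Bj|Bj] := ltP 0 (qform B (z j)).
    by have := v_ratio _ (zP j).1 Bj; rewrite lee_fin ler_pdivlMr.
  (* The nonlinear ingredient is that [v + lambda >= 0] times [qform B (z j) <= 0] is
     nonpositive. *)
  by have := dual_ge0 _ (zP j).1; nra.
- apply: ereal_inf_le_tmp => _ [z [Sz Bz] <-].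
  by exists (outer z); rewrite /= !mxinner_outer.
Qed.
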